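(* Let $r=(r_i)_{i=1}^\infty$ be a non-decreasing sequence of positive integers. For $d\ge2$, let $\mathbf F_d$ be the Korobov space of varying smoothness on $[0,1]^d$ given by $r$, let $\widetilde{\mathbf F}_d$ be its $3^d$-dimensional subspace of trigonometric polynomials of order at most one in each variable, and let $\mathbf S_d(f)=\int_{[0,1]^d}f(x)\,dx$. Put $L^{\inf}:=\liminf_{i\to\infty}\frac{\ln i}{r_i}$. (i) If $r$ is bounded, then numerical integration $\mathbf S_d$ on $\widetilde{\mathbf F}_d$ (and hence also on $\mathbf F_d$) suffers from the curse of dimensionality. (ii) If $L^{\inf}=\infty$, then numerical integration on $\widetilde{\mathbf F}_d$ (and hence also on $\mathbf F_d$) satisfies: for any $\varepsilon\in(0,1)$ and $\beta>0$ there is a constant $c_{\varepsilon,\beta}>0$, independent of $d$, such that $$n(\varepsilon,\mathbf S_d)\ \ge\ c_{\varepsilon,\beta}\exp\bigl(d^{1-\beta}\bigr).$$ (iii) If $L^{\inf}>2\ln(2\pi)$, then numerical integration on $\widetilde{\mathbf F}_d$ (and hence also on $\mathbf F_d$) is not polynomially tractable.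
   Context: For a positive integer $m$, $H_{1,m}$ is the space of 1-periodic real-valued functions $f$ on $[0,1]$ such that $f^{(m-1)}$ is absolutely continuous and $f^{(m)}\in L_2([0,1])$, with Hilbert norm $\|f\|_{H_{1,m}}^2=\bigl|\int_0^1f(x)\,dx\bigr|^2+\int_0^1|f^{(m)}(x)|^2dx$. The Korobov space of varying smoothness is the Hilbert space tensor product $\mathbf F_d=H_{1,r_1}\otimes\cdots\otimes H_{1,r_d}$, i.e. the reproducing kernel Hilbert space on $[0,1]^d$ whose kernel is the product of the kernels of the $H_{1,r_i}$. Let $\widetilde H_{1,r_i}\subset H_{1,r_i}$ be the span of $1,\cos(2\pi x),\sin(2\pi x)$ with the norm of $H_{1,r_i}$, and $\widetilde{\mathbf F}_d=\widetilde H_{1,r_1}\otimes\cdots\otimes\widetilde H_{1,r_d}$. For a continuous linear functional $S$ on a RKHS $F$ on $D$, $$e(n,S)=\inf_{x_1,\dots,x_n\in D}\ \inf_{c\in\mathbb R^n}\ \sup_{\|f\|_F\le1}\Bigl|S(f)-\sum_{j=1}^nc_jf(x_j)\Bigr|,\qquad n(\varepsilon,S)=\min\{n: e(n,S)\le\varepsilon\}.$$ The curse of dimensionality means that, for a fixed error demand $\varepsilon\in(0,1)$, $n(\varepsilon,\mathbf S_d)$ grows at least exponentially in $d$ (there are $c>0$, $a>1$ with $n(\varepsilon,\mathbf S_d)\ge c\,a^d$ for all $d$). The problem is polynomially tractable if there are constants $C,p,q>0$ such that $n(\varepsilon,\mathbf S_d)\le C\,d^p\varepsilon^{-q}$ for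 all $\varepsilon>0$ and $d\in\mathbb N$. *)

(* Defs.v *)
(* Built on MathComp and MathComp-Analysis. *)
From HB Require Import structures.
From mathcomp Require Import all_boot all_order all_algebra.
From mathcomp Require Import all_classical all_reals all_analysis.
Import Order.TTheory GRing.Theory Num.Theory.
Import numFieldTopology.Exports numFieldNormedType.Exports.

Set Implicit Arguments.
Unset Strict Implicit.
Unset Printing Implicit Defensive.

Local Open Scope classical_set_scope.
Local Open Scope ring_scope.

(* The product measure m1 \x mu transported to tuples by (t, x) |-> t :: x. *)
Section cons_measure.
Context (disp : measure_display) (T : measurableType disp) (R : realType).
Variables (n : nat) (m1 : {sigma_finite_measure set T -> \bar R}).
Variable mu : {sigma_finite_measure set (n.-tuple T) -> \bar R}.

Definition tuple_cons (p : T * n.-tuple T) : n.+1.-tuple T :=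
  [tuple of p.1 :: p.2].

Definition tuple_uncons (x : n.+1.-tuple T) : T * n.-tuple T :=
  (thead x, [tuple of behead x]).

Lemma measurable_tuple_cons : measurable_fun setT tuple_cons.
Proof. exact: measurable_cons. Qed.

Lemma measurable_tuple_uncons : measurable_fun setT tuple_uncons.
Proof.
apply/measurable_fun_pairP; split; last exact: measurable_behead.
exact: (@measurable_tnth _ T n.+1 ord0).
Qed.

Lemma tuple_consK : cancel tuple_cons tuple_uncons.
Proof. by case=> t x; congr pair => //; exact/val_inj. Qed.

Definition cons_measure : set (n.+1.-tuple T) -> \bar R :=
  pushforward (m1 \x mu)%E tuple_cons.

Let cons_measure0 : cons_measure set0 = 0%E.
Proof. by rewrite /cons_measure /pushforward preimage_set0 measure0. Qed.

Let cons_measure_ge0 A : (0 <= cons_measure A)%E.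
Proof. by rewrite /cons_measure /pushforward measure_ge0. Qed.

Let cons_measure_sigma_additive : semi_sigma_additive cons_measure.
Proof.
move=> F mF tF mUF; rewrite /cons_measure /pushforward preimage_bigcup.
apply: measure_semi_sigma_additive.
- move=> i; rewrite -[X in measurable X]setTI.
  exact: measurable_tuple_cons.
- apply/trivIsetP => /= i j _ _ ij; rewrite -preimage_setI.
  by move/trivIsetP : tF => /(_ _ _ _ _ ij) ->//; rewrite preimage_set0.
- rewrite -preimage_bigcup -[X in measurable X]setTI.
  exact: measurable_tuple_cons.
Qed.

HB.instance Definition _ := isMeasure.Build _ _ _ cons_measure
  cons_measure0 cons_measure_ge0 cons_measure_sigma_additive.

Let cons_measure_sigma_finite : sigma_finite setT cons_measure.
Proof.
have /sigma_finiteP[F [UF ndF Foo]] := sigma_finiteT m1.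
have /sigma_finiteP[G [UG ndG Goo]] := sigma_finiteT mu.
exists (fun k => tuple_uncons @^-1` (F k `*` G k)).
  rewrite -preimage_bigcup (_ : \bigcup_k (F k `*` G k) = setT) ?preimage_setT//.
  rewrite -subTset => -[t x] _.
  have [k _ Fkt] : (\bigcup_k F k) t by rewrite -UF.
  have [l _ Glx] : (\bigcup_k G k) x by rewrite -UG.
  exists (maxn k l) => //; split.
    by move: Fkt; exact/subsetPset/ndF/leq_maxl.
  by move: Glx; exact/subsetPset/ndG/leq_maxr.
move=> k; have [mF Fk] := Foo k; have [mG Gk] := Goo k; split.
  rewrite -[X in measurable X]setTI; apply: measurable_tuple_uncons => //.
  exact: measurableX.
rewrite /cons_measure /pushforward -comp_preimage.
rewrite (_ : tuple_uncons \o tuple_cons = id) ?preimage_id; last first.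
  by apply/funext => p; exact: tuple_consK.
by rewrite product_measure1E// lte_mul_pinfty// ge0_fin_numE.
Qed.

HB.instance Definition _ := Measure_isSigmaFinite.Build _ _ _ cons_measure
  cons_measure_sigma_finite.

End cons_measure.

Notation Rspace R d := (d.-tuple (measurableTypeR R)).

(* Lebesgue measure on R^d; R^0 is a point of mass one. *)
Fixpoint lebesgue_tuple (R : realType) (d : nat) :
    {sigma_finite_measure set (Rspace R d) -> \bar R} :=
  match d with
  | 0 => @dirac _ (Rspace R 0) [tuple] R
  | d'.+1 => cons_measure (@lebesgue_measure R) (lebesgue_tuple R d')
  end.

Definition unit_interval (R : realType) : set R := `[0, 1]%classic.
Arguments unit_interval R : clear implicits.

Definition unit_cube (R : realType) (d : nat) : set (Rspace R d) :=
  [set x | forall i, unit_interval R (tnth x i)].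
Arguments unit_cube R d : clear implicits.

Definition cube_integral (R : realType) (d : nat) (f : Rspace R d -> R) : R :=
  (\int[lebesgue_tuple R d]_(x in unit_cube R d) f x)%R.

(* A real vector space of functions on T together with an inner product; fdot
   is only meaningful on members of fmem. *)
Record function_space (R : realType) (T : Type) := FunctionSpace {
  fmem : set (T -> R);
  fdot : (T -> R) -> (T -> R) -> R }.

Definition fnorm (R : realType) (T : Type) (F : function_space R T)
  (f : T -> R) : R := Num.sqrt (fdot F f f).

(* A Hilbert space of functions with continuous point evaluations. *)
Record is_rkhs (R : realType) (T : Type) (F : function_space R T) : Prop := {
  rkhs0 : fmem F (cst 0);
  rkhsP : forall (a : R) f g, fmem F f -> fmem F g -> fmem F (a *: f + g);
  rkhs_dotC : forall f g, fmem F f -> fmem F g -> fdot F f g = fdot F g f;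
  rkhs_dotP : forall (a : R) f g h, fmem F f -> fmem F g -> fmem F h ->
    fdot F (a *: f + g) h = a * fdot F f h + fdot F g h;
  rkhs_dot_ge0 : forall f, fmem F f -> 0 <= fdot F f f;
  rkhs_dot_eq0 : forall f, fmem F f -> fdot F f f = 0 -> f = cst 0;
  rkhs_complete : forall u : nat -> T -> R, (forall k, fmem F (u k)) ->
    (forall e, 0 < e ->
      exists N, forall k l, (N <= k)%N -> (N <= l)%N ->
        fnorm F (u k - u l) < e) ->
    exists2 f, fmem F f & (fun k => fnorm F (u k - f)) @ \oo --> (0 : R);
  rkhs_eval : forall x, exists C, forall f, fmem F f ->
    `|f x| <= C * fnorm F f }.

Definition tensor (R : realType) (d : nat) (f : 'I_d -> R -> R) :
  Rspace R d -> R := fun x => \prod_(i < d) f i (tnth x i).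

(* F is the Hilbert space tensor product of H_0, ..., H_(d-1), realized as a
   space of functions on R^d: the elementary tensors lie in F, have the product
   inner product, and span a dense subspace. Together with the continuity of
   point evaluations this determines F, which is the reproducing kernel Hilbert
   space whose kernel is the product of the kernels of the H_i. *)
Record is_hilbert_tensor (R : realType) (d : nat)
    (H : 'I_d -> function_space R R) (F : function_space R (Rspace R d)) :
    Prop := {
  tensor_rkhs : is_rkhs F;
  tensor_mem : forall f, (forall i, fmem (H i) (f i)) -> fmem F (tensor f);
  tensor_dot : forall f g,
    (forall i, fmem (H i) (f i)) -> (forall i, fmem (H i) (g i)) ->
    fdot F (tensor f) (tensor g) = \prod_(i < d) fdot (H i) (f i) (g i);
  tensor_dense : forall f (e : R), fmem F f -> 0 < e ->
    exists n (a : 'I_n -> R) (g : 'I_n -> 'I_d -> R -> R),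
      (forall k i, fmem (H i) (g k i)) /\
      fnorm F (f - \sum_(k < n) a k *: tensor (g k)) < e }.

Definition absolutely_continuous (R : realType) (a b : R) (f : R -> R) :=
  forall e, 0 < e -> exists2 delta, 0 < delta &
    forall n (u v : 'I_n -> R),
      (forall i, [/\ a <= u i, u i <= v i & v i <= b]) ->
      trivIset setT (fun i => `]u i, v i[%classic) ->
      \sum_(i < n) (v i - u i) < delta ->
      \sum_(i < n) `|f (v i) - f (u i)| < e.

(* The space H_{1,m}, m >= 1. A 1-periodic function on [0, 1] is represented by
   its periodic extension to R, so that the boundary conditions are part of the
   regularity of f. The derivative f^`(m) exists almost everywhere. *)
Definition sobolev_mem (R : realType) (m : nat) (f : R -> R) : Prop :=
  [/\ forall x, f (x + 1) = f x,
      forall k x, (k < m.-1)%N -> derivable (derive1n k f) x 1,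
      absolutely_continuous 0 1 (derive1n m.-1 f),
      measurable_fun (unit_interval R) (derive1n m f) &
      (\int[@lebesgue_measure R]_(x in unit_interval R)
         ((derive1n m f x) ^+ 2)%:E < +oo)%E].

Definition sobolev_dot (R : realType) (m : nat) (f g : R -> R) : R :=
  (\int[@lebesgue_measure R]_(x in unit_interval R) f x)%R *
  (\int[@lebesgue_measure R]_(x in unit_interval R) g x)%R +
  (\int[@lebesgue_measure R]_(x in unit_interval R)
     (derive1n m f x * derive1n m g x))%R.

Definition periodic_sobolev (R : realType) (m : nat) : function_space R R :=
  FunctionSpace (sobolev_mem m) (sobolev_dot m).

Definition trig_mem (R : realType) (f : R -> R) : Prop :=
  exists a b c : R, f = fun x =>
    a + b * cos (2 * pi * x) + c * sin (2 * pi * x).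

Definition trig_sobolev (R : realType) (m : nat) : function_space R R :=
  FunctionSpace (@trig_mem R) (sobolev_dot m).

(* r is indexed from 1: the i-th coordinate, i = 1, ..., d, is the ordinal i-1. *)
Definition is_korobov (R : realType) (r : nat -> nat) (d : nat)
    (F : function_space R (Rspace R d)) : Prop :=
  is_hilbert_tensor (fun i : 'I_d => periodic_sobolev R (r i.+1)) F.

Definition is_trig_korobov (R : realType) (r : nat -> nat) (d : nat)
    (F : function_space R (Rspace R d)) : Prop :=
  is_hilbert_tensor (fun i : 'I_d => trig_sobolev R (r i.+1)) F.

Section information_complexity.
Context (R : realType) (T : Type).
Variables (D : set T) (F : function_space R T) (S : (T -> R) -> R).

Definition worst_case_error (n : nat) (x : 'I_n -> T) (c : 'I_n -> R) :
    \bar R :=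
  ereal_sup [set (`|S f - \sum_(j < n) c j * f (x j)|)%:E |
             f in [set f | fmem F f /\ fnorm F f <= 1]].

Definition minimal_error (n : nat) : \bar R :=
  ereal_inf [set ereal_inf [set worst_case_error x c | c in setT] |
             x in [set x : 'I_n -> T | forall j, D (x j)]].

(* The least n with minimal_error n <= eps, and +oo if there is none. *)
Definition complexity (eps : R) : \bar R :=
  ereal_inf [set (n%:R)%:E | n in [set n | (minimal_error n <= eps%:E)%E]].

End information_complexity.

Definition integration_complexity (R : realType) (d : nat)
    (F : function_space R (Rspace R d)) (eps : R) : \bar R :=
  complexity (unit_cube R d) F (@cube_integral R d) eps.

(* Families of problems are indexed by d >= 2; N d eps is the information
   complexity of the d-th problem. *)
Definition curse_of_dimensionality (R : realType) (N : nat -> R -> \bar R) :=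
  forall eps : R, 0 < eps < 1 ->
    exists c a : R, [/\ 0 < c, 1 < a &
      forall d, (2 <= d)%N -> ((c * a ^+ d)%:E <= N d eps)%E].

Definition polynomially_tractable (R : realType) (N : nat -> R -> \bar R) :=
  exists C p q : R, [/\ 0 < C, 0 < p, 0 < q &
    forall (eps : R) d, 0 < eps -> (2 <= d)%N ->
      (N d eps <= (C * d%:R `^ p * eps `^ (- q))%:E)%E].

(* n(eps, S_d) >= c_{eps,beta} exp(d^(1-beta)) *)
Definition almost_exponential_growth (R : realType) (N : nat -> R -> \bar R) :=
  forall eps beta : R, 0 < eps < 1 -> 0 < beta ->
    exists2 c : R, 0 < c &
      forall d, (2 <= d)%N -> ((c * expR (d%:R `^ (1 - beta)))%:E <= N d eps)%E.

Definition Linf (R : realType) (r : nat -> nat) : \bar R :=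
  limn_einf (fun i => (ln (i%:R : R) / (r i)%:R)%:E).

(* Main.v *)
(** The representer of integration is the constant 1, so the squared error
    of a quadrature rule with nodes x_j and weights c_j is at least 1 - 2
    sum_j c_j + sum_(i,j) c_i c_j K(x_i, x_j), where K(x, y) = prod_k (1 + 2
    l_k cos (2 pi (x_k - y_k))) and l_k = (2 pi)^(- 2 r_k). Since 1 + 2 l
    cos(2 pi t) = (1 - 2 l) + 4 l cos(pi t)^2, K is a nonnegative
    combination of squares of positive semidefinite kernels that are 1 on
    the diagonal. For such a square A o A on n points Schur's product
    theorem sharpens to A o A >= 1 1^T / n. Hence K >= (P / n) 1 1^T with P
    = prod_k (1 + 2 l_k), the squared error is at least 1 - n / P, and the
    complexity is at least (1 - eps^2) P. If ln k / r_k is eventually larger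
    than kappa, then l_k >= k^(-gamma) for large k with gamma = 2 ln(2 pi) /
    kappa, so that P >= const * exp (d^(1 - gamma)). *)
Require Import Defs.
From mathcomp Require Import all_boot all_order all_algebra zify ring lra.
From mathcomp Require Import all_classical all_reals all_analysis.
From mathcomp Require Import measurable_realfun.
Import Order.TTheory GRing.Theory Num.Theory.
Import numFieldTopology.Exports numFieldNormedType.Exports.

Set Implicit Arguments.
Unset Strict Implicit.
Unset Printing Implicit Defensive.

Local Open Scope classical_set_scope.
Local Open Scope ring_scope.

(** * Projectors, a sharpened Schur inequality and the kernel bound *)

(** Gram-Schmidt by induction: a new vector adds to [P] the rank-one projector onto its component
    orthogonal to the previous ones, so the trace, which is the rank, grows by at most one. *)
Lemma ex_projector (R : realFieldType) (n m : nat) (u : 'I_n -> 'rV[R]_m) :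
  exists P : 'M[R]_m, [/\ P^T = P, P *m P = P,
    forall i, u i *m P = u i & \tr P <= n%:R].
Proof.
elim: n u => [|n IHn] u.
  exists 0; split=> [|||]; first by rewrite trmx0.
  - by rewrite mulmx0.
  - by case.
  - by rewrite mxtrace0.
have [P [PT PP Pu Ptr]] := IHn (u \o lift ord0).
have [v vE] : exists v, v = u ord0 - u ord0 *m P by eexists.
have vP : v *m P = 0 by rewrite vE mulmxBl -mulmxA PP subrr.
have PvT : P *m v^T = 0 by rewrite -PT -trmx_mul vP trmx0.
pose q := (v *m v^T) 0 0.
have vvT : v *m v^T = q%:M by rewrite {1}[v *m v^T]mx11_scalar.
(* [q] is the squared length of [v]; if it vanishes, the new vector is already fixed by [P]. *)
have [q0|qN0] := eqVneq q 0.
  exists P; split=> // [i|]; last by rewrite (le_trans Ptr)// ler_nat.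
  have v0 : v = 0.
    apply/rowP => j; rewrite mxE; move/eqP: q0.
    rewrite /q mxE psumr_eq0 => [/allP/(_ j)|k _]; last first.
      by rewrite mxE -expr2 sqr_ge0.
    rewrite mem_index_enum => /(_ isT)/=.
    by rewrite !mxE mulf_eq0 orbb => /eqP.
  have [j ->|->] := unliftP ord0 i; first exact: Pu.
  by apply/esym/eqP; rewrite -subr_eq0 -vE v0.
have vQ : v *m (v^T *m v) = q *: v by rewrite mulmxA vvT mul_scalar_mx.
exists (P + q^-1 *: (v^T *m v)); split.
- by rewrite linearD/= linearZ/= trmx_mul trmxK PT.
- rewrite mulmxDl !mulmxDr PP -!scalemxAl -!scalemxAr (mulmxA P) PvT.
  rewrite mul0mx scaler0 addr0 -(mulmxA _ v P) vP mulmx0 scaler0 add0r.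
  by rewrite -(mulmxA v^T) vQ -scalemxAr scalerA mulVf// scale1r.
- move=> i; rewrite mulmxDr -scalemxAr.
  have [j ->|->] := unliftP ord0 i.
    have uvT : u (lift ord0 j) *m v^T = 0.
      by rewrite -[u _](Pu j) -mulmxA PvT mulmx0.
    by rewrite mulmxA uvT mul0mx scaler0 addr0; exact: Pu.
  have -> : u ord0 = v + u ord0 *m P by rewrite vE subrK.
  rewrite mulmxDl vP add0r -!mulmxA PP mulmxDl vQ (mulmxA (u ord0 *m P)).
  rewrite -(mulmxA _ P) PvT mulmx0 mul0mx addr0 scalerA mulVf// scale1r.
  by rewrite addrC.
- rewrite linearD/= linearZ/= mxtrace_mulC vvT mxtrace_scalar mulVf//.
  by rewrite -natr1 lerD2r.
Qed.

(* With M = sum_i c_i u_i^T u_i, the claim is (tr M)^2 <= n |M|^2; it is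
   Cauchy-Schwarz for tr M = <P, M>, where P is a projector of rank at most n
   onto a space containing the u_i. *)
Lemma gram_schur_le (R : realFieldType) (n m : nat) (u : 'I_n -> 'rV[R]_m)
    (c : 'I_n -> R) :
  (\sum_i c i * (u i *m (u i)^T) 0 0) ^+ 2 <=
  n%:R * \sum_i \sum_j c i * c j * (u i *m (u j)^T) 0 0 ^+ 2.
Proof.
have [P [PT PP Pu Ptr]] := ex_projector u.
pose M : 'M[R]_m := \sum_i c i *: ((u i)^T *m u i).
have trM : \sum_i c i * (u i *m (u i)^T) 0 0 = \tr M.
  rewrite linear_sum/=; apply: eq_bigr => i _.
  by rewrite linearZ/= mxtrace_mulC trace_mx11.
have MT : M^T = M.
  rewrite linear_sum/=; apply: eq_bigr => i _.
  by rewrite linearZ/= trmx_mul trmxK.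
have MP : M *m P = M.
  rewrite mulmx_suml; apply: eq_bigr => i _.
  by rewrite -scalemxAl -mulmxA Pu.
have trMM : \sum_i \sum_j c i * c j * (u i *m (u j)^T) 0 0 ^+ 2 = \tr (M *m M).
  rewrite mulmx_suml linear_sum/=; apply: eq_bigr => i _.
  rewrite mulmx_sumr linear_sum/=; apply: eq_bigr => j _.
  rewrite -scalemxAl -scalemxAr scalerA linearZ/=; congr (_ * _).
  rewrite mulmxA mxtrace_mulC !mulmxA -mulmxA.
  rewrite [u j *m _]mx11_scalar mul_scalar_mx linearZ/= trace_mx11 expr2.
  by congr (_ * _); rewrite -[u j *m _]trmxK trmx_mul trmxK [RHS]mxE.
rewrite trM trMM.
have sqr_tr_ge0 (A : 'M[R]_m) : A^T = A -> 0 <= \tr (A *m A).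
  move=> AT; rewrite /mxtrace sumr_ge0// => i _; rewrite mxE sumr_ge0// => j _.
  have -> : A j i = A i j by rewrite -[in LHS]AT mxE.
  by rewrite -expr2 sqr_ge0.
have [n0|n_gt0] := posnP n.
  have -> : M = 0.
    by rewrite /M; move: (u) (c); rewrite n0 => ? ?; rewrite big_ord0.
  by rewrite mxtrace0 expr0n/= mul0mx mxtrace0 mulr0.
(* Expand 0 <= |M - t P|^2 <= |M|^2 - 2 t tr M + n t^2; this [t] minimizes the right-hand side. *)
pose t := \tr M / n%:R.
have nN0 : n%:R != 0 :> R by rewrite pnatr_eq0 -lt0n.
have /sqr_tr_ge0 : (M - t *: P)^T = M - t *: P.
  by rewrite linearB/= linearZ/= MT PT.
have PM : \tr (P *m M) = \tr M by rewrite mxtrace_mulC MP.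
rewrite mulmxBl !mulmxBr -!scalemxAl -!scalemxAr MP PP !linearB/= !linearZ/=.
rewrite PM linearZ/= => H.
have {}H : 0 <= \tr (M *m M) - 2 * t * \tr M + t ^+ 2 * n%:R.
  apply: (le_trans H).
  have := ler_wpM2l (sqr_ge0 t) Ptr.
  clearbody t; move: (\tr M) (\tr P) (\tr (M *m M)) (n%:R : R) => x y z k.
  rewrite -![_ *: _]/(_ * _); nra.
have tE : \tr M = t * n%:R by rewrite /t mulfVK.
rewrite tE exprMn; move: H; rewrite tE => H.
have := mulr_ge0 (ler0n R n) H; clearbody t.
by move: (n%:R : R) (\tr (M *m M)) => x y; nra.
Qed.

Lemma korobov_kernel_ge (R : realType) (d n : nat) (lam : 'I_d -> R)
    (x : 'I_n -> 'I_d -> R) (c : 'I_n -> R) :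
  (forall k, 0 <= 2 * lam k <= 1) ->
  \prod_k (1 + 2 * lam k) * (\sum_i c i) ^+ 2 <=
  n%:R * \sum_i \sum_j c i * c j *
    \prod_k (1 + 2 * lam k * cos (2 * pi * (x i k - x j k))).
Proof.
move=> lam01.
(* [f] picks in each coordinate one summand of (1 - 2 l) + 4 l cos(pi (s - t))^2; [W f] is the
   coefficient of the resulting term, and all [W f] add up to the product of the 1 + 2 l. *)
pose W (f : {ffun 'I_d -> bool}) :=
  \prod_k (if f k then 4 * lam k else 1 - 2 * lam k).
pose kap (b : bool) (s t : R) := if b then cos (pi * (s - t)) else 1.
(* Feature map of [kap b] into R^2: the addition formula of the cosine if [b] holds, the constant
   kernel 1 otherwise. *)
pose phi (b e : bool) (s : R) :=
  if b then (if e then cos (pi * s) else sin (pi * s)) else if e then 1 else 0.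
have kapE b s t : kap b s t = \sum_e phi b e s * phi b e t.
  rewrite big_bool /kap /phi; case: b => /=; last by rewrite mulr0 mulr1 addr0.
  by rewrite mulrBr cosB.
have WE : \prod_k (1 + 2 * lam k) = \sum_f W f.
  pose F k (b : bool) := if b then 4 * lam k else 1 - 2 * lam k.
  rewrite -(bigA_distr_bigA F); apply: eq_bigr => k _.
  by rewrite big_bool /F/=; ring.
have KE i j : \prod_k (1 + 2 * lam k * cos (2 * pi * (x i k - x j k))) =
    \sum_f W f * (\prod_k kap (f k) (x i k) (x j k)) ^+ 2.
  pose F k (b : bool) :=
    (if b then 4 * lam k else 1 - 2 * lam k) * kap b (x i k) (x j k) ^+ 2.
  under [RHS]eq_bigr do rewrite -prodrXl -big_split/=.
  rewrite -(bigA_distr_bigA F); apply: eq_bigr => k _.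
  have -> : 2 * pi * (x i k - x j k) = (pi * (x i k - x j k)) *+ 2.
    by rewrite -mulrA mulr_natl.
  by rewrite big_bool /F /kap cos_mulr2n /=; move: (cos _) => w; ring.
under [X in _ <= _ * X]eq_bigr do under eq_bigr do rewrite KE mulr_sumr.
under [X in _ <= _ * X]eq_bigr do rewrite exchange_big/=.
rewrite exchange_big/= mulr_sumr WE mulr_suml ler_sum// => f _.
have W_ge0 : 0 <= W f.
  apply: prodr_ge0 => k _; have := lam01 k; case: ifP => _ /andP[? ?]; lra.
(* Tensor products of the features: their Gram matrix is the product of the [kap], with unit
   diagonal. *)
pose u i : 'rV[R]_#|{: {ffun 'I_d -> bool}}| :=
  \row_a \prod_k phi (f k) ((enum_val a : {ffun _ -> _}) k) (x i k).
have uE i j : (u i *m (u j)^T) 0 0 = \prod_k kap (f k) (x i k) (x j k).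
  under [RHS]eq_bigr do rewrite kapE.
  rewrite bigA_distr_bigA/= [RHS]big_enum_val/= mxE.
  by apply: eq_bigr => a _; rewrite !mxE big_split.
have := ler_wpM2l W_ge0 (gram_schur_le u c).
have -> : \sum_i c i * (u i *m (u i)^T) 0 0 = \sum_i c i.
  apply: eq_bigr => i _; rewrite uE big1 ?mulr1// => k _.
  by rewrite /kap; case: ifP => // _; rewrite subrr mulr0 cos0.
move=> /le_trans; apply; rewrite mulrCA ler_wpM2l ?ler0n// mulr_sumr.
rewrite ler_sum// => i _; rewrite mulr_sumr ler_sum// => j _.
by rewrite uE mulrCA.
Qed.

(** * Derivatives and integrals of trigonometric polynomials of order one *)

(** A family closed under differentiation, so that derivatives, integrals and inner products are
    computed on coefficients. *)
Definition trig (R : realType) (a b c : R) : R -> R :=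
  fun x => a + b * cos (2 * pi * x) + c * sin (2 * pi * x).

Section trig.
Variable R : realType.
Implicit Types (a b c w x : R) (f : R -> R).
Let leb := @lebesgue_measure R.

Lemma is_derive_cosM w x :
  is_derive x (1 : R) (fun x : R => cos (w * x)) (- (w * sin (w * x))).
Proof.
have H : is_derive x (1 : R) (fun x : R => w * x) w.
  by apply: is_derive_eq; rewrite -[_ *: _]/(_ * _) mulr1.
rewrite mulrC -mulNr.
exact: (@is_derive1_comp _ cos _ x).
Qed.

Lemma is_derive_sinM w x :
  is_derive x (1 : R) (fun x : R => sin (w * x)) (w * cos (w * x)).
Proof.
have H : is_derive x (1 : R) (fun x : R => w * x) w.
  by apply: is_derive_eq; rewrite -[_ *: _]/(_ * _) mulr1.
rewrite mulrC.
exact: (@is_derive1_comp _ sin _ x).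
Qed.

Lemma is_derive_trig a b c x :
  is_derive x (1 : R) (trig a b c) (trig 0 (2 * pi * c) (- (2 * pi * b)) x).
Proof.
have H1 := is_derive_cosM (2 * pi) x.
have H2 := is_derive_sinM (2 * pi) x.
rewrite /trig; apply: is_derive_eq.
rewrite -![_ *: _]/(_ * _); ring.
Qed.

Lemma continuous_trig a b c : continuous (trig a b c).
Proof.
move=> x; apply/differentiable_continuous/derivable1_diffP.
by have := is_derive_trig a b c x.
Qed.

Lemma derive1_trig a b c :
  derive1 (trig a b c) = trig 0 (2 * pi * c) (- (2 * pi * b)).
Proof.
apply/funext => x; rewrite derive1E.
by have H := is_derive_trig a b c x; rewrite derive_val.
Qed.

Lemma integral01_FTC f (G : R -> R) :
  continuous f -> (forall x, is_derive x (1 : R) G (f x)) ->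
  (\int[leb]_(x in unit_interval R) f x)%R = G 1 - G 0.
Proof.
move=> cf dG.
have cG : continuous G.
  move=> x; apply/differentiable_continuous/derivable1_diffP.
  by have := dG x.
rewrite /Rintegral (@continuous_FTC2 _ f G)//.
- exact: continuous_subspaceT.
- split=> [x _||]; first by have := dG x.
  + exact/cvg_at_right_filter/cG.
  + exact/cvg_at_left_filter/cG.
- by move=> x _; rewrite derive1E; have H := dG x; rewrite derive_val.
Qed.

Lemma cos2pi1 : cos (2 * pi * 1) = 1 :> R.
Proof. by rewrite mulr1 mulr_natl cos2pi. Qed.

Lemma sin2pi1 : sin (2 * pi * 1) = 0 :> R.
Proof. by rewrite mulr1 mulr_natl sin2pi. Qed.

Lemma twopi_neq0 : 2 * pi != 0 :> R.
Proof. by rewrite mulf_neq0 ?pnatr_eq0// lt0r_neq0// pi_gt0. Qed.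

Lemma integral01_trig a b c :
  (\int[leb]_(x in unit_interval R) trig a b c x)%R = a.
Proof.
pose G x := a * x + trig 0 (- (c / (2 * pi))) (b / (2 * pi)) x.
have dG x : is_derive x (1 : R) G (trig a b c x).
  have H := is_derive_trig 0 (- (c / (2 * pi))) (b / (2 * pi)) x.
  rewrite /G; apply: is_derive_eq; rewrite -![_ *: _]/(_ * _) /trig.
  by clear; have := lt0r_neq0 (pi_gt0 R); move: (@pi R) => p p0; field.
rewrite (integral01_FTC _ dG); last exact: continuous_trig.
rewrite /G /trig cos2pi1 sin2pi1 !mulr0 cos0 sin0; move: (c / _) => v; ring.
Qed.

Lemma integral01_trigM a b c a' b' c' :
  (\int[leb]_(x in unit_interval R) (trig a b c x * trig a' b' c' x))%R =
  a * a' + (b * b' + c * c') / 2.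
Proof.
pose A := a * a' + (b * b' + c * c') / 2.
pose w : R := 2 * pi; have w0 : w != 0 := twopi_neq0.
(* An antiderivative of the product. Its trigonometric terms agree at 0 and 1, so only [A * x]
   contributes. *)
pose G x := A * x + (a * b' + b * a') / w * sin (w * x)
  - (a * c' + c * a') / w * cos (w * x)
  + (b * b' - c * c') / (2 * w) * (sin (w * x) * cos (w * x))
  + (b * c' + c * b') / (2 * w) * (sin (w * x) * sin (w * x)).
have dG x : is_derive x (1 : R) G (trig a b c x * trig a' b' c' x).
  have H1 := is_derive_cosM w x; have H2 := is_derive_sinM w x.
  rewrite /G; apply: is_derive_eq; rewrite -![_ *: _]/(_ * _) /trig -/w.
  have := cos2Dsin2 (w * x); rewrite /A; clear H1 H2 G A.
  set u := cos _; set v := sin _ => uv.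
  clearbody w; move: uv => /eqP; rewrite -subr_eq0 => /eqP uv.
  apply/eqP; rewrite -subr_eq0; apply/eqP.
  rewrite [LHS](_ : _ = (u ^+ 2 + v ^+ 2 - 1) * - ((b * b' + c * c') / 2));
    last by field.
  by rewrite uv mul0r.
rewrite (integral01_FTC _ dG); last first.
  by move=> x; apply: cvgM; exact: continuous_trig.
have [cw sw] : cos w = 1 /\ sin w = 0 by rewrite -[w]mulr1 cos2pi1 sin2pi1.
by rewrite /G !mulr1 !mulr0 cw sw cos0 sin0 /A; clear dG; clearbody w; field.
Qed.

Lemma integrable01 f : continuous f ->
  leb.-integrable (unit_interval R) (EFin \o f).
Proof.
move=> cf; apply: continuous_compact_integrable; first exact: segment_compact.
exact: continuous_subspaceT.
Qed.

End trig.

(** * The Sobolev inner product on trigonometric polynomials *)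

Section trig_sobolev.
Variable R : realType.
Implicit Types (a b c w x y lam : R) (f : R -> R) (m : nat).

(** Differentiation on the cosine and sine coefficients: a quarter turn scaled by 2 pi, which
    multiplies inner products by (2 pi)^2. *)
Let rot (p : R * R) := (2 * pi * p.2, - (2 * pi * p.1)).

Lemma derive1n_trig m a b c :
  derive1n m (trig a b c) =
  trig (if m is 0 then a else 0) (iter m rot (b, c)).1 (iter m rot (b, c)).2.
Proof.
elim: m => [|m IHm]; first by rewrite derive1n0.
by rewrite derive1nS IHm derive1_trig.
Qed.

Let rot_dot m p q :
  (iter m rot p).1 * (iter m rot q).1 + (iter m rot p).2 * (iter m rot q).2 =
  (2 * pi) ^+ (2 * m) * (p.1 * q.1 + p.2 * q.2).
Proof.
elim: m p q => [|m IHm] p q; first by rewrite mul1r.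
rewrite !iterSr IHm mulnS exprD /=.
by move: (2 * pi) (_ ^+ (2 * m)) => w z; ring.
Qed.

(** Integration keeps only the constant term and, since m > 0, differentiation removes it. *)
Lemma sobolev_dot_trig m a b c a' b' c' : (0 < m)%N ->
  sobolev_dot m (trig a b c) (trig a' b' c') =
  a * a' + (2 * pi) ^+ (2 * m) * (b * b' + c * c') / 2.
Proof.
move=> m0; rewrite /sobolev_dot !integral01_trig !derive1n_trig.
rewrite integral01_trigM rot_dot/=; case: m m0 => // m _.
by rewrite mul0r add0r.
Qed.

Lemma trig_lipschitz a b c : exists2 L, 0 <= L &
  forall x y, x <= y -> `|trig a b c y - trig a b c x| <= L * (y - x).
Proof.
exists (`|2 * pi * c| + `|2 * pi * b|); first by rewrite addr_ge0.
move=> x y xy.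
have ct := @continuous_trig R a b c.
have [t _ ->] := MVT_segment xy (fun z _ => is_derive_trig a b c z)
  (continuous_subspaceT ct).
rewrite normrM (ger0_norm (x := y - x)) ?subr_ge0// ler_wpM2r ?subr_ge0//.
rewrite /trig add0r (le_trans (ler_normD _ _))// lerD//.
  by rewrite normrM ler_piMr// ler_norml cos_geN1 cos_le1.
by rewrite normrM normrN ler_piMr// ler_norml sin_geN1 sin_le1.
Qed.

Lemma absolutely_continuous_trig a b c :
  absolutely_continuous 0 1 (trig a b c).
Proof.
have [L L0 lipL] := trig_lipschitz a b c.
move=> e e0; have L1 : 0 < L + 1 by rewrite ltr_wpDl.
exists (e / (L + 1)); first by rewrite divr_gt0.
move=> n u v uv _ uve.
have uvi i : u i <= v i by case: (uv i).
apply: le_lt_trans (_ : (L + 1) * \sum_i (v i - u i) < e); last first.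
  by rewrite mulrC -ltr_pdivlMr.
rewrite mulr_sumr ler_sum// => i _; rewrite (le_trans (lipL _ _ (uvi i)))//.
by rewrite ler_wpM2r ?subr_ge0// lerDl.
Qed.

(** This inclusion makes the bound obtained from trigonometric tensors available in the full Korobov
    space. *)
Lemma sobolev_mem_trig m a b c : sobolev_mem m (trig a b c).
Proof.
split=> [x|k x _|||].
- rewrite /trig.
  have -> : 2 * pi * (x + 1) = 2 * pi * x + pi *+ 2.
    by rewrite mulrDr mulr1 mulr_natl.
  by rewrite cosD2pi sinD2pi.
- rewrite derive1n_trig.
  exact: (@ex_derive _ _ _ _ _ _ _ (is_derive_trig _ _ _ x)).
- by rewrite derive1n_trig; exact: absolutely_continuous_trig.
- rewrite derive1n_trig; apply: measurable_funTS.
  apply: continuous_measurable_fun; exact: continuous_trig.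
- rewrite derive1n_trig; set f := trig _ _ _.
  have cf : continuous (fun x => f x ^+ 2).
    by move=> x; apply: cvgM; exact: continuous_trig.
  have /integrableP[mf2] := integrable01 cf.
  apply: le_lt_trans; apply: ge0_le_integral => //=.
  + exact: measurable_itv.
  + by move=> x _; rewrite lee_fin sqr_ge0.
  + apply/measurable_EFinP; apply: measurableT_comp => //.
    exact/measurable_EFinP.
  + by move=> x _; rewrite lee_fin ler_norm.
Qed.

(** For lam = (2 pi)^(-2 m) this is the reproducing kernel of the trigonometric space at [y]; for
    lam = 0 it is the constant 1, the representer of integration. *)
Definition trig_kernel lam y : R -> R :=
  trig 1 (2 * lam * cos (2 * pi * y)) (2 * lam * sin (2 * pi * y)).

Lemma trig_kernelE lam y x :
  trig_kernel lam y x = 1 + 2 * lam * cos (2 * pi * (y - x)).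
Proof. by rewrite /trig_kernel /trig mulrBr cosB; ring. Qed.

Lemma trig_kernel0 y : trig_kernel 0 y = cst 1.
Proof.
by apply/funext => x; rewrite trig_kernelE mulr0 mul0r addr0.
Qed.

Lemma sobolev_dot_kernel m y z : (0 < m)%N ->
  sobolev_dot m (trig_kernel ((2 * pi) ^- (2 * m)) y)
    (trig_kernel ((2 * pi) ^- (2 * m)) z) =
  1 + 2 * (2 * pi) ^- (2 * m) * cos (2 * pi * (y - z)).
Proof.
move=> m0; rewrite sobolev_dot_trig// mulrBr cosB mulr1; congr (_ + _).
have : (2 * pi) ^+ (2 * m) != 0 :> R by rewrite expf_neq0 ?twopi_neq0.
by move: (_ ^+ (2 * m)) => w w0; field.
Qed.

Lemma sobolev_dot1_kernel m lam y : (0 < m)%N ->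
  sobolev_dot m (cst 1) (trig_kernel lam y) = 1.
Proof.
move=> m0; rewrite -(trig_kernel0 0) sobolev_dot_trig//.
by rewrite !mulr0 !mul0r addr0 mulr0 mul0r addr0 mulr1.
Qed.

End trig_sobolev.

(** * Integrals of tensors over R^d and over the cube *)

Section tensor_integral.
Variable R : realType.
Let leb := @lebesgue_measure R.

Lemma measurable_tensor d (f : 'I_d -> R -> R) :
  (forall i, measurable_fun setT (f i)) -> measurable_fun setT (tensor f).
Proof.
move=> mf; rewrite /tensor; apply: measurable_prod => i _.
exact: (measurableT_comp (mf i) (measurable_tnth i)).
Qed.

Lemma tensor_cons d (f : 'I_d.+1 -> R -> R) (t : R) (x : Rspace R d) :
  tensor f (tuple_cons (t, x)) =
  f ord0 t * tensor (fun i => f (lift ord0 i)) x.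
Proof.
rewrite /tensor big_ord_recl/=; congr (_ * _).
by apply: eq_bigr => i _; rewrite tnthS.
Qed.

(** Induction on the dimension: [tuple_cons] carries a product measure to the measure on R^(d+1),
    and Fubini splits off the first coordinate. *)
Lemma integrable_tensor d (f : 'I_d -> R -> R) :
  (forall i, leb.-integrable setT (EFin \o f i)) ->
  (lebesgue_tuple R d).-integrable setT (EFin \o tensor f) /\
  (\int[lebesgue_tuple R d]_x (tensor f x)%:E =
   (\prod_(i < d) (\int[leb]_x f i x)%R)%:E)%E.
Proof.
elim: d f => [|d IHd] f intf.
  have f1 : EFin \o tensor f = cst 1%E.
    by apply/funext => x; rewrite /= /tensor big_ord0.
  split; last first.
    rewrite big_ord0; under eq_integral => x _ do rewrite /tensor big_ord0.
    by rewrite /= integral_dirac// diracT mul1e.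
  rewrite f1; apply/integrableP; split; first exact: measurable_cst.
  under eq_integral => x _ do rewrite /= normr1.
  by rewrite /= integral_dirac// diracT mul1e ltry.
pose g i := f (lift ord0 i).
have [intg Ig] := IHd g (fun i => intf (lift ord0 i)).
have mf i : measurable_fun setT (f i).
  by apply/measurable_EFinP; exact: measurable_int (intf i).
have mF : measurable_fun setT (EFin \o tensor f).
  by apply/measurable_EFinP; exact: measurable_tensor.
pose G : measurableTypeR R * Rspace R d -> \bar R :=
  fun p => (f ord0 p.1 * tensor g p.2)%:E.
have FG : (EFin \o tensor f) \o @tuple_cons _ (measurableTypeR R) d = G.
  by apply/funext => -[t x]; rewrite /= tensor_cons.
have mG : measurable_fun setT G.
  rewrite -FG; apply: (measurableT_comp mF).
  exact: (@measurable_tuple_cons _ (measurableTypeR R) d).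
have intG : (leb \x lebesgue_tuple R d)%E.-integrable setT G.
  (* Tonelli: the integral of |G| is a product of two finite integrals. *)
  apply/integrable12ltyP => //.
  have [_ foo] := integrableP _ _ _ (intf ord0).
  have [_ goo] := integrableP _ _ _ intg.
  have -> : (\int[leb]_t \int[lebesgue_tuple R d]_x `|G (t, x)| =
      \int[leb]_t (`|f ord0 t|%:E *
        \int[lebesgue_tuple R d]_x `|(EFin \o tensor g) x|))%E.
    apply: eq_integral => t _; rewrite -ge0_integralZl//; last first.
      by apply: measurableT_comp => //; exact: measurable_int intg.
    by apply: eq_integral => x _; rewrite /= normrM EFinM.
  rewrite ge0_integralZr//; last 2 first.
  - by apply/measurable_EFinP; apply: measurableT_comp => //; exact: mf.
  - exact: integral_ge0.
  rewrite lte_mul_pinfty// ?integral_ge0//.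
  by rewrite fin_num_abs gee0_abs// integral_ge0.
have intF : (lebesgue_tuple R d.+1).-integrable setT (EFin \o tensor f).
  apply: integrable_pushforward => //; first exact: measurable_tuple_cons.
  by rewrite preimage_setT FG.
split=> //.
have mcons := @measurable_tuple_cons _ (measurableTypeR R) d.
rewrite [LHS](integral_pushforward mcons mF)//; last first.
  by rewrite preimage_setT FG.
rewrite preimage_setT.
rewrite -[X in integral _ _ X]/((EFin \o tensor f) \o @tuple_cons _ _ d).
rewrite FG -integral12_prod_meas1// /fubini_F /G /=.
under eq_integral => t _.
  under eq_integral => x _ do rewrite EFinM.
  rewrite integralZl// Ig.
  over.
rewrite integralZr//; last exact: intf.
rewrite big_ord_recl EFinM /Rintegral fineK//.
exact: (integrable_fin_num measurableT (intf ord0)).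
Qed.
End tensor_integral.

Section cube.
Variables (R : realType) (d : nat).
Let leb := @lebesgue_measure R.
Let mu := lebesgue_tuple R d.

Lemma measurable_unit_cube : measurable (unit_cube R d).
Proof.
have -> : unit_cube R d =
    \bigcap_(i in [set: 'I_d])
      ((fun x : Rspace R d => tnth x i) @^-1` unit_interval R).
  by apply/seteqP; split=> x /= xI i; [move=> _|]; exact: xI.
apply: fin_bigcap_measurable => // i _.
rewrite -[X in measurable X]setTI.
apply: (@measurable_tnth _ (measurableTypeR R) d i) => //.
exact: measurable_itv.
Qed.

(** Outside the cube some factor vanishes. This turns integrals over the cube into integrals over
    R^d. *)
Lemma restrict_tensor (f : 'I_d -> R -> R) :
  tensor f \_ (unit_cube R d) = tensor (fun i => f i \_ (unit_interval R)).
Proof.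
apply/funext => x; rewrite patchE /tensor; case: ifPn => [|/negP xN].
  rewrite inE => xI; apply: eq_bigr => i _.
  by rewrite patchE ifT// inE; exact: xI.
have [i xi] : exists i, ~ unit_interval R (tnth x i).
  by apply/existsNP => xI; apply: xN; rewrite inE.
rewrite (bigD1 i)//= patchE ifF ?mul0r//.
by apply/negbTE/negP; rewrite inE.
Qed.

Lemma cube_integral_tensor (f : 'I_d -> R -> R) :
  (forall i, continuous (f i)) ->
  mu.-integrable (unit_cube R d) (EFin \o tensor f) /\
  cube_integral (tensor f) =
  \prod_(i < d) (\int[leb]_(x in unit_interval R) f i x)%R.
Proof.
move=> cf; have mcube := measurable_unit_cube.
have [|intf If] := @integrable_tensor R d (fun i => f i \_ (unit_interval R)).
  move=> i; rewrite -restrict_EFin.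
  have mI : measurable (unit_interval R) by exact: measurable_itv.
  exact: (iffLR (@integrable_mkcond _ _ R leb _ _ mI) (integrable01 (cf i))).
split.
  by apply/integrable_mkcond => //; rewrite restrict_EFin restrict_tensor.
rewrite /cube_integral Rintegral_mkcond restrict_tensor /Rintegral If /=.
by apply: eq_bigr => i _; rewrite -/(Rintegral _ _ _) -Rintegral_mkcond.
Qed.

Lemma cube_integral_sum n (c : 'I_n -> R) (g : 'I_n -> Rspace R d -> R) :
  (forall j, mu.-integrable (unit_cube R d) (EFin \o g j)) ->
  mu.-integrable (unit_cube R d) (EFin \o (\sum_j c j *: g j)) /\
  cube_integral (\sum_j c j *: g j) = \sum_j c j * cube_integral (g j).
Proof.
move=> intg; have mcube := measurable_unit_cube.
apply: (big_rec2 (fun (f : Rspace R d -> R) v =>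
  mu.-integrable (unit_cube R d) (EFin \o f) /\ cube_integral f = v)).
  split; first exact: (integrable0 mu).
  by rewrite /cube_integral (Rintegral_cst _ mcube) mul0r.
move=> j f v _ [intf <-].
have intcg : mu.-integrable (unit_cube R d) (EFin \o (c j *: g j)).
  have -> : EFin \o (c j *: g j) =
    (fun x => (c j)%:E * (EFin \o g j) x)%E by [].
  exact: integrableZl.
split.
  have -> : EFin \o (c j *: g j + f) =
    ((EFin \o (c j *: g j)) \+ (EFin \o f))%E by [].
  exact: integrableD.
by rewrite /cube_integral RintegralD// RintegralZl.
Qed.

End cube.

(** * Worst-case errors in a reproducing kernel Hilbert space *)

Section rkhs.
Variables (R : realType) (T : Type) (F : function_space R T).
Hypothesis rkhsF : is_rkhs F.

Lemma rkhs_memZ a f : fmem F f -> fmem F (a *: f).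
Proof.
by move=> Ff; have := rkhsP rkhsF a Ff (rkhs0 rkhsF); rewrite addr0.
Qed.

Lemma rkhs_dot0l f : fmem F f -> fdot F 0 f = 0.
Proof.
move=> Ff; have F0 := rkhs0 rkhsF.
by have := rkhs_dotP rkhsF (-1) F0 F0 Ff; rewrite scaler0 addr0 mulN1r addNr.
Qed.

Lemma rkhs_dotZl a f g : fmem F f -> fmem F g ->
  fdot F (a *: f) g = a * fdot F f g.
Proof.
move=> Ff Fg; have := rkhs_dotP rkhsF a Ff (rkhs0 rkhsF) Fg.
by rewrite addr0 rkhs_dot0l// addr0.
Qed.

Lemma rkhs_sum n (c : 'I_n -> R) (g : 'I_n -> T -> R) f :
  (forall j, fmem F (g j)) -> fmem F f ->
  fmem F (\sum_j c j *: g j) /\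
  fdot F (\sum_j c j *: g j) f = \sum_j c j * fdot F (g j) f.
Proof.
move=> Fg Ff.
apply: (big_rec2 (fun u v => fmem F u /\ fdot F u f = v)).
  by split; [exact: rkhs0|exact: rkhs_dot0l].
move=> j u v _ [Fu <-]; split; first exact: rkhsP.
exact: rkhs_dotP.
Qed.

(* Fooled by h - sum_j c_j k_j, the difference of the representers of S and of
   the quadrature rule. *)
Lemma worst_case_error_ge (S : (T -> R) -> R) n (x : 'I_n -> T)
    (c : 'I_n -> R) (h : T -> R) (k : 'I_n -> T -> R) (q : R) :
  fmem F h -> (forall j, fmem F (k j)) ->
  fdot F h h = 1 -> (forall j, fdot F h (k j) = 1) ->
  (forall i j, fdot F (k i) (k j) = k i (x j)) -> (forall j, h (x j) = 1) ->
  (forall a b, S (a *: h - \sum_j b j *: k j) = a - \sum_j b j) ->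
  q = 1 - 2 * \sum_j c j + \sum_i \sum_j c i * c j * k i (x j) ->
  0 < q -> ((Num.sqrt q)%:E <= worst_case_error F S x c)%E.
Proof.
move=> Fh Fk hh hk kk hx Sh qE q_gt0.
pose w := \sum_j c j *: k j; pose g := h - w.
have Fw : fmem F w := (rkhs_sum c Fk Fh).1.
have gE : g = (-1) *: w + h by rewrite scaleN1r addrC.
have Fg : fmem F g by rewrite gE; exact: rkhsP.
have dotC := rkhs_dotC rkhsF.
have wh : fdot F w h = \sum_j c j.
  rewrite (rkhs_sum c Fk Fh).2; apply: eq_bigr => j _.
  by rewrite dotC// hk mulr1.
have ww : fdot F w w = \sum_i \sum_j c i * c j * k i (x j).
  rewrite (rkhs_sum c Fk Fw).2; apply: eq_bigr => i _.
  rewrite dotC// (rkhs_sum c Fk (Fk i)).2 mulr_sumr; apply: eq_bigr => j _.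
  by rewrite dotC// kk mulrA.
have gg : fdot F g g = q.
  rewrite {1}gE (rkhs_dotP rkhsF)// (dotC w)// (dotC h)// gE.
  rewrite !(rkhs_dotP rkhsF)// (dotC h w)// wh ww hh qE; ring.
have sq_gt0 : 0 < Num.sqrt q by rewrite sqrtr_gt0.
(* [g] has squared norm [q]; scaled to norm one it is integrated with error s q = sqrt q. *)
pose s := (Num.sqrt q)^-1.
have Fsg : fmem F (s *: g) by exact: rkhs_memZ.
apply: ereal_sup_ubound; exists (s *: g).
  split=> //; rewrite /fnorm rkhs_dotZl// dotC// rkhs_dotZl// gg.
  rewrite mulrA -expr2 exprVn sqr_sqrtr ?(ltW q_gt0)// mulVf ?lt0r_neq0//.
  by rewrite sqrtr1.
congr EFin.
have gx j : g (x j) = 1 - \sum_i c i * k i (x j).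
  rewrite /g /w !fctE hx; congr (1 - _).
  by elim/big_rec2 : _ => // i u f _ <-; rewrite !fctE.
(* [Sh] evaluates [S] on combinations of [h] and the [k j], so [s *: g] is written as one. *)
have sg : s *: g = s *: h - \sum_j (s * c j) *: k j.
  rewrite scalerBr scaler_sumr; congr (_ - _).
  by apply: eq_bigr => j _; rewrite scalerA.
rewrite [X in S X]sg Sh -mulr_sumr.
have -> : \sum_j c j * (s *: g) (x j) =
    s * (\sum_j c j - \sum_i \sum_j c i * c j * k i (x j)).
  rewrite exchange_big/= -sumrB mulr_sumr; apply: eq_bigr => j _.
  rewrite -[(s *: g) _]/(s * g (x j)) gx mulrCA; congr (_ * _).
  rewrite mulrBr mulr1 mulr_sumr; congr (_ - _).
  by apply: eq_bigr => i _; ring.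
have -> : s - s * \sum_j c j -
    s * (\sum_j c j - \sum_i \sum_j c i * c j * k i (x j)) = s * q.
  by rewrite qE; ring.
rewrite -[q in s * q]sqr_sqrtr ?ltW// expr2 mulKf ?lt0r_neq0//.
by rewrite ger0_norm// ltW.
Qed.

End rkhs.

(** * Lower bound on the complexity of integration *)

(** The upper bound keeps 1 - 2 l nonnegative in the kernel decomposition and later gives exp l <= 1
    + 2 l. *)
Lemma korobov_weight_bounds (R : realType) m : (0 < m)%N ->
  0 < (2 * pi : R) ^- (2 * m) <= 2^-1.
Proof.
move=> m_gt0; have pi2 := pi_ge2 R; have pi0 : 0 < 2 * pi :> R by lra.
rewrite invr_gt0 exprn_gt0//= lef_pV2 ?posrE ?exprn_gt0 ?ltr0n//.
case: m m_gt0 => // m _; rewrite mulnS exprS -[leLHS]mulr1 ler_pM//; first lra.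
by rewrite exprn_ege1//; lra.
Qed.

Section complexity_lower_bound.
Variables (R : realType) (d : nat) (m : 'I_d -> nat).
Hypothesis m_gt0 : forall i, (0 < m i)%N.
Variable F : function_space R (Rspace R d).
Hypothesis rkhsF : is_rkhs F.
Hypothesis tensorF : forall f : 'I_d -> R -> R,
  (forall i, trig_mem (f i)) -> fmem F (tensor f).
Hypothesis dotF : forall f g : 'I_d -> R -> R,
  (forall i, trig_mem (f i)) -> (forall i, trig_mem (g i)) ->
  fdot F (tensor f) (tensor g) = \prod_(i < d) sobolev_dot (m i) (f i) (g i).

Let lam i : R := (2 * pi) ^- (2 * m i).
Let P : R := \prod_(i < d) (1 + 2 * lam i).

(** The constant 1, written as a tensor so that [dotF] applies to it. *)
Let h : Rspace R d -> R := tensor (fun _ => trig_kernel 0 0).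
Let k (y : Rspace R d) : Rspace R d -> R :=
  tensor (fun i => trig_kernel (lam i) (tnth y i)).

Let trig_mem_kernel l y : trig_mem (trig_kernel l y : R -> R).
Proof. by do 3!eexists; reflexivity. Qed.

Let h1 x : h x = 1.
Proof. by rewrite /h /tensor big1// => i _; rewrite trig_kernel0. Qed.

Let lam_bounds i : 0 < lam i /\ 2 * lam i <= 1.
Proof.
have /andP[l0 l1] := korobov_weight_bounds R (m_gt0 i); split=> //.
by rewrite mulrC -ler_pdivlMr// mul1r.
Qed.

Let P_ge1 : 1 <= P.
Proof.
rewrite /P; elim/big_rec : _ => // i x _ x1.
by rewrite -[leLHS]mulr1 ler_pM// lerDl mulr_ge0// ltW// (lam_bounds i).1.
Qed.

Let integral_comb n (x : 'I_n -> Rspace R d) a (b : 'I_n -> R) :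
  cube_integral (a *: h - \sum_j b j *: k (x j)) = a - \sum_j b j.
Proof.
have cont l y : continuous (trig_kernel l y : R -> R) by exact: continuous_trig.
have [inth Ih] := @cube_integral_tensor R d _ (fun _ => cont 0 0).
have {}Ih : cube_integral h = 1.
  by rewrite Ih big1// => i _; exact: integral01_trig.
have kI j := @cube_integral_tensor R d _ (fun i => cont (lam i) (tnth (x j) i)).
have Ik j : cube_integral (k (x j)) = 1.
  by rewrite (kI j).2 big1// => i _; exact: integral01_trig.
have [ints Is] := cube_integral_sum b (fun j => (kI j).1).
have mc := @measurable_unit_cube R d.
rewrite /cube_integral RintegralB//; last exact: (integrableZl mc a inth).
rewrite RintegralZl// -!/(cube_integral _) Ih mulr1 Is; congr (_ - _).
by apply: eq_bigr => j _; rewrite Ik mulr1.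
Qed.

(** For n > 0 the kernel bound gives q >= 1 - 2 s + (P / n) s^2, whose minimum over [s], at s = n /
    P, is 1 - n / P. *)
Lemma worst_case_error_korobov n (x : 'I_n -> Rspace R d) (c : 'I_n -> R) :
  n%:R < P ->
  ((Num.sqrt (1 - n%:R / P))%:E <=
    worst_case_error F (@cube_integral R d) x c)%E.
Proof.
move=> nP; have P_gt0 : 0 < P by exact: lt_le_trans P_ge1.
pose s := \sum_j c j.
pose Q := \sum_i \sum_j c i * c j * k (x i) (x j).
pose q := 1 - 2 * s + Q.
have kE i j : k (x i) (x j) =
    \prod_l (1 + 2 * lam l * cos (2 * pi * (tnth (x i) l - tnth (x j) l))).
  by apply: eq_bigr => l _; rewrite trig_kernelE.
have PQ : P * s ^+ 2 <= n%:R * Q.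
  rewrite /Q; under eq_bigr do under eq_bigr do rewrite kE.
  apply: korobov_kernel_ge => l; have [l0 ->] := lam_bounds l.
  by rewrite andbT mulr_ge0// ltW.
have qP : 1 - n%:R / P <= q.
  have [n0|n_gt0] := posnP n.
    rewrite /q /Q /s; move: (x) (c); rewrite n0 => ? ?.
    by rewrite !big_ord0 mulr0 mul0r subr0 addr0.
  have n0 : 0 < n%:R :> R by rewrite ltr0n.
  rewrite -(ler_pM2l n0) /q.
  have H : 0 <= P * (s - n%:R / P) ^+ 2 by rewrite mulr_ge0 ?sqr_ge0// ltW.
  rewrite -subr_ge0; apply: (le_trans H); rewrite -subr_ge0.
  have -> : n%:R * (1 - 2 * s + Q) - n%:R * (1 - n%:R / P) -
    P * (s - n%:R / P) ^+ 2 = n%:R * Q - P * s ^+ 2.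
    by field; rewrite lt0r_neq0.
  by rewrite subr_ge0.
have q_gt0 : 0 < q.
  by apply: lt_le_trans qP; rewrite subr_gt0 ltr_pdivrMr// mul1r.
apply: (@le_trans _ _ (Num.sqrt q)%:E); first by rewrite lee_fin ler_wsqrtr.
apply: (@worst_case_error_ge _ _ _ rkhsF _ _ _ _ h (fun j => k (x j))) => //.
- exact: tensorF.
- by move=> j; exact: tensorF.
- rewrite dotF// big1// => i _.
  by rewrite [X in sobolev_dot _ X]trig_kernel0 sobolev_dot1_kernel.
- move=> j; rewrite dotF// big1// => i _.
  by rewrite trig_kernel0 sobolev_dot1_kernel.
- move=> i j; rewrite dotF// kE; apply: eq_bigr => l _.
  exact: sobolev_dot_kernel.
Qed.

(** With n < (1 - eps^2) P nodes every rule has error at least sqrt(1 - n / P) > eps. Beyond the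
    Hilbert structure, the section assumes only facts on trigonometric tensors, so both kinds of
    Korobov space qualify. *)
Lemma integration_complexity_ge (eps : R) : 0 < eps < 1 ->
  (((1 - eps ^+ 2) * \prod_(i < d) (1 + 2 * (2 * pi) ^- (2 * m i)))%:E <=
   integration_complexity F eps)%E.
Proof.
move=> /andP[eps0 eps1]; rewrite -/P.
have P_gt0 : 0 < P by exact: lt_le_trans P_ge1.
apply/ereal_infP => _ [n /= Hn <-]; rewrite lee_fin leNgt; apply/negP => nP.
have nP' : n%:R < P.
  by apply: (lt_le_trans nP); rewrite ler_piMl ?(ltW P_gt0)// gerBl sqr_ge0.
have : ((Num.sqrt (1 - n%:R / P))%:E <= eps%:E)%E.
  apply: le_trans Hn; apply/ereal_infP => _ [x _ <-].
  by apply/ereal_infP => _ [c _ <-]; exact: worst_case_error_korobov.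
rewrite lee_fin leNgt => /negP; apply.
rewrite -[ltLHS]ger0_norm ?(ltW eps0)// -sqrtr_sqr ltr_sqrt; last first.
  by rewrite subr_gt0 ltr_pdivrMr// mul1r.
by rewrite ltrBrDl -ltrBrDr ltr_pdivrMr.
Qed.

End complexity_lower_bound.

(** * Elementary estimates for the product of the 1 + 2 l *)

(** Combine exp(-x) >= 1 - x with (1 - x) (1 + 2 x) = 1 + x (1 - 2 x) >= 1. *)
Lemma expR_le_1D2x (R : realType) (x : R) :
  0 <= x <= 2^-1 -> expR x <= 1 + 2 * x.
Proof.
move=> /andP[x0 x2].
have H : expR (- x) >= 1 - x by exact: expR_ge1Dx.
have H1 : expR (- x) * expR x = 1 by rewrite mulrC expRxMexpNx_1.
have H2 := expR_gt0 x; have := expR_gt0 (- x).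
have : (1 - x) * (1 + 2 * x) >= 1 by nra.
move=> H3 H4; nra.
Qed.

(** After taking logarithms this is kappa m < ln i multiplied by 2 ln(2 pi) / kappa. *)
Lemma powR_le_of_ln_gt (R : realType) (kappa : R) (i m : nat) :
  (0 < i)%N -> (0 < m)%N -> 0 < kappa -> kappa < ln (i%:R : R) / m%:R ->
  (i%:R : R) `^ (- (2 * ln (2 * pi) / kappa)) <= (2 * pi) ^- (2 * m).
Proof.
move=> i0 m0 k0 km; have pi0 : 0 < 2 * pi :> R by rewrite mulr_gt0// pi_gt0.
have {}m0 : 0 < m%:R :> R by rewrite ltr0n.
have l0 : 0 < ln (2 * pi) :> R.
  by rewrite ln_gt0//; have := pi_ge2 R; lra.
have i0R : 0 < i%:R :> R by rewrite ltr0n.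
rewrite powRN lef_pV2 ?posrE ?exprn_gt0 ?powR_gt0//.
rewrite -ler_ln ?posrE ?exprn_gt0 ?powR_gt0// lnXn// ln_powR.
rewrite -[ln _ *+ _]mulr_natl natrM [leRHS]mulrAC ler_pdivlMr//.
move: km; rewrite ltr_pdivlMr// => km.
have -> : 2 * m%:R * ln (2 * pi) * kappa =
    2 * ln (2 * pi) * (kappa * m%:R) :> R.
  by move: (ln (2 * pi)) => z; ring.
by rewrite ler_wpM2l ?(ltW km)// mulr_ge0// ltW.
Qed.

(** The lower limit is the supremum of the tail infima, so one of these exceeds [l]. *)
Lemma limn_einf_gt (R : realType) (u : nat -> \bar R) (l : \bar R) :
  (l < limn_einf u)%E -> exists N, forall i, (N <= i)%N -> (l < u i)%E.
Proof.
rewrite limn_einf_lim.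
rewrite (cvg_lim _ (ereal_nondecreasing_cvgn (@nondecreasing_einfs _ u)))//.
move=> /ereal_sup_gt[_ [N _ <-] lN]; exists N => i Ni.
by apply: (lt_le_trans lN); apply: ereal_inf_lbound; exists i.
Qed.

(** Each factor with i >= N is at least exp(d^(-gam)). All d factors together would give exp(d^(1 -
    gam)); the at most N remaining ones lose a factor exp(d^(-gam)) <= e each. *)
Lemma prod_ge_exp (R : realType) (gam : R) (lam : nat -> R) (N : nat) :
  (0 < N)%N -> 0 < gam ->
  (forall i, (0 < i)%N -> 0 < lam i <= 2^-1) ->
  (forall i, (N <= i)%N -> i%:R `^ (- gam) <= lam i) ->
  forall d, (0 < d)%N ->
  expR (- N%:R) * expR (d%:R `^ (1 - gam)) <= \prod_(i < d) (1 + 2 * lam i.+1).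
Proof.
move=> N0 gam0 lam0 lamN d d0; rewrite -expRD.
have dgt0 : 0 < d%:R :> R by rewrite ltr0n.
pose e (i : 'I_d) := if (i < N)%N then 0 else d%:R `^ (- gam) : R.
have dg1 : d%:R `^ (- gam) <= 1 :> R.
  rewrite -[leRHS](powRr0 d%:R); apply: ler_powR; first by rewrite ler1n.
  by rewrite oppr_le0 ltW.
apply: (@le_trans _ _ (expR (\sum_(i < d) e i))); last first.
  rewrite expR_sum; apply: ler_prod => i _; rewrite expR_ge0/= /e.
  have /andP[l0 l2] := lam0 i.+1 isT.
  case: ltnP => [_|Ni]; first by rewrite expR0 lerDl mulr_ge0// ltW.
  apply: (@le_trans _ _ (expR (lam i.+1))); last by rewrite expR_le_1D2x// ltW.
  rewrite ler_expR; apply: le_trans (lamN i.+1 (leqW Ni)).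
  rewrite !powRN lef_pV2 ?posrE ?powR_gt0 ?ltr0n//.
  by rewrite ge0_ler_powR ?nnegrE ?ler_nat// ltW.
rewrite ler_expR.
have -> : d%:R `^ (1 - gam) = \sum_(i < d) d%:R `^ (- gam) :> R.
  rewrite sumr_const card_ord -[RHS]mulr_natl powRD; last first.
    by rewrite lt0r_neq0// implybT.
  by rewrite powRr1// ltW.
rewrite addrC lerBlDr -lerBlDl -sumrB.
apply: (@le_trans _ _ (\sum_(i < d) (i < N)%N%:R)).
  apply: ler_sum => i _; rewrite /e; case: ltnP => _; first by rewrite subr0.
  by rewrite subrr.
(* The induction on [d] carries the sharper bound min(d, N). *)
rewrite -natr_sum ler_nat; apply: leq_trans (geq_minr d N).
elim: (d) => [|k IHk]; first by rewrite big_ord0.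
rewrite big_ord_recr/=; move: IHk; move: (\sum_(i < k) _)%N => t.
by case: ltnP; lia.
Qed.

(** * The three growth regimes *)

Section growth.
Variables (R : realType) (r : nat -> nat).
Hypothesis r_gt0 : forall i, (1 <= i)%N -> (1 <= r i)%N.
Let lam i : R := (2 * pi) ^- (2 * r i).
Variable N : nat -> R -> \bar R.
Hypothesis N_ge : forall d eps, (2 <= d)%N -> 0 < eps < 1 ->
  (((1 - eps ^+ 2) * \prod_(i < d) (1 + 2 * lam i.+1))%:E <= N d eps)%E.

Let twopi_gt1 : 1 < 2 * pi :> R.
Proof. by have := pi_ge2 R; lra. Qed.

Let twopi_gt0 : 0 < 2 * pi :> R. Proof. exact: lt_trans twopi_gt1. Qed.

Let one_sqr_gt0 (eps : R) : 0 < eps < 1 -> 0 < 1 - eps ^+ 2.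
Proof. by move=> /andP[e0 e1]; rewrite subr_gt0 exprn_ilt1// ltW. Qed.

Lemma bounded_curse M : (forall i, (1 <= i)%N -> (r i <= M)%N) ->
  curse_of_dimensionality N.
Proof.
(* The base is the value of a factor at r = M, a lower bound for all factors. *)
move=> rM eps eps01; exists (1 - eps ^+ 2), (1 + 2 * (2 * pi) ^- (2 * M)).
have a0 : 0 < 2 * (2 * pi) ^- (2 * M) :> R.
  by rewrite mulr_gt0// invr_gt0 exprn_gt0.
split; [exact: one_sqr_gt0|by rewrite ltrDl|].
move=> d d2; apply: le_trans (N_ge d2 eps01).
rewrite lee_fin ler_wpM2l ?(ltW (one_sqr_gt0 _))//.
rewrite -[X in _ ^+ X]card_ord -prodr_const; apply: ler_prod => i _.
rewrite addr_ge0 ?(ltW a0)//= lerD2l ler_wpM2l// lef_pV2 ?posrE ?exprn_gt0//.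
by rewrite ler_weXn2l ?(ltW twopi_gt1)// leq_mul2l rM.
Qed.

Lemma prod_ge_exp_of_Linf kappa : 0 < kappa -> (kappa%:E < Linf R r)%E ->
  exists2 c : R, 0 < c & forall d eps, (2 <= d)%N -> 0 < eps < 1 ->
    (((1 - eps ^+ 2) * c * expR (d%:R `^ (1 - 2 * ln (2 * pi) / kappa)))%:E
      <= N d eps)%E.
Proof.
move=> k0 /limn_einf_gt[N0 HN0].
(* The successor makes the threshold positive, so that only indices i >= 1 occur. *)
exists (expR (- (N0.+1)%:R)); first exact: expR_gt0.
move=> d eps d2 eps01; apply: le_trans (N_ge d2 eps01).
rewrite lee_fin -mulrA ler_wpM2l ?(ltW (one_sqr_gt0 _))//.
apply: (@prod_ge_exp _ _ lam) => //; last exact: ltnW.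
- by rewrite divr_gt0// mulr_gt0// ln_gt0.
- by move=> i i0; apply: korobov_weight_bounds; exact: r_gt0.
- move=> i Ni; have i0 := leq_trans (ltn0Sn N0) Ni.
  apply: powR_le_of_ln_gt => //; first exact: r_gt0.
  by rewrite -lte_fin HN0// ltnW.
Qed.

Lemma infinite_Linf_growth : Linf R r = +oo%E -> almost_exponential_growth N.
Proof.
move=> Loo eps beta eps01 beta0.
have l0 : 0 < 2 * ln (2 * pi) :> R by rewrite mulr_gt0// ln_gt0.
(* This kappa makes the exponent exactly 1 - beta. *)
have [||c c0 Hc] := @prod_ge_exp_of_Linf (2 * ln (2 * pi) / beta).
- by rewrite divr_gt0.
- by rewrite Loo ltry.
exists ((1 - eps ^+ 2) * c); first by rewrite mulr_gt0 ?one_sqr_gt0.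
move=> d d2; have := Hc d eps d2 eps01.
by rewrite invf_div mulrCA divff ?mulr1// lt0r_neq0.
Qed.

(** Already at eps = 1/2 the bound exp(d^del) with del > 0 outgrows every polynomial in d: with L =
    ln d, exp(del L) >= (del L)^2 / 2 beats ln K + p L. *)
Lemma large_Linf_not_tractable : ((2 * ln (2 * pi))%:E < Linf R r)%E ->
  ~ polynomially_tractable N.
Proof.
have l0 : 0 < 2 * ln (2 * pi) :> R by rewrite mulr_gt0// ln_gt0.
(* The strict inequality leaves room for a kappa with 2 ln(2 pi) / kappa < 1, that is [del] > 0. *)
move=> lL; have [kappa lk kL] : exists2 kappa,
    2 * ln (2 * pi) < kappa & (kappa%:E < Linf R r)%E.
  case: (Linf R r) lL => [L|_|//]; last first.
    by exists (2 * ln (2 * pi) + 1); rewrite ?ltrDl ?ltry.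
  rewrite lte_fin => lL; exists ((2 * ln (2 * pi) + L) / 2).
    by rewrite midf_lt.
  by rewrite lte_fin midf_lt.
have k0 : 0 < kappa by exact: lt_trans lk.
have [c c0 Hc] := prod_ge_exp_of_Linf k0 kL.
set del := 1 - _ in Hc.
have del0 : 0 < del by rewrite subr_gt0 ltr_pdivrMr// mul1r.
move=> [C [p [q [C0 p0 q0 HN]]]].
have half01 : 0 < (2^-1 : R) < 1 by lra.
pose K := C * 2^-1 `^ (- q) / ((1 - 2^-1 ^+ 2) * c).
have K0 : 0 < K by rewrite divr_gt0 ?mulr_gt0 ?powR_gt0 ?one_sqr_gt0.
have bound d : (2 <= d)%N ->
    (del * ln d%:R) ^+ 2 / 2 <= ln K + p * ln (d%:R : R).
  move=> d2; have d0 : 0 < d%:R :> R by rewrite ltr0n ltnW.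
  have L0 : 0 <= ln (d%:R : R) by rewrite ln_ge0// ler1n ltnW.
  have x0 : 0 <= del * ln (d%:R : R) by rewrite mulr_ge0// ltW.
  have := le_trans (Hc d _ d2 half01) (HN 2^-1 d _ d2).
  rewrite invr_gt0 lee_fin => /(_ (ltr0n _ _)).
  rewrite -[leRHS]mulrAC -ler_pdivlMl ?mulr_gt0 ?one_sqr_gt0//.
  have -> : ((1 - 2^-1 ^+ 2) * c)^-1 * (C * 2^-1 `^ (- q) * d%:R `^ p) =
      expR (ln K + p * ln d%:R).
    rewrite expRD lnK ?posrE// /K -[d%:R `^ p]lnK ?posrE ?powR_gt0// ln_powR.
    by rewrite mulrA [_^-1 * _]mulrC.
  rewrite ler_expR => H; rewrite (le_trans _ H)//.
  rewrite -[d%:R `^ _]lnK ?posrE ?powR_gt0// ln_powR.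
  have := expR_ge1Dxn 1 x0; rewrite (_ : 2`!%:R = 2)//.
  by move=> /(le_trans _) -> //; rewrite lerDr.
(* ln d > B gives L >= 1 and L del^2 > 2 (p + |ln K|), whence (del L)^2 / 2 > p L + |ln K| L >= p L
   + ln K. The [.+2] in [d] ensures d >= 2. *)
pose B := 1 + 2 * (p + `|ln K|) / del ^+ 2.
pose d := (Num.bound (expR B)).+2.
have Bd : B < ln (d%:R : R).
  rewrite -ltr_expR lnK ?posrE ?ltr0n//.
  rewrite (lt_le_trans (archi_boundP (expR_ge0 _)))// ler_nat.
  exact: leqW (leqnSn _).
have := bound d isT; clearbody d; move: (ln d%:R) Bd => L.
have nK := ler_norm (ln K); have nK0 := normr_ge0 (ln K).
have d2 : 0 < del ^+ 2 by rewrite exprn_gt0.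
have e0 : 0 <= 2 * (p + `|ln K|) / del ^+ 2.
  by rewrite divr_ge0 ?(ltW d2)// mulr_ge0// addr_ge0// ltW.
rewrite /B; set t := _ / _ in e0 * => BL; have L1 : 1 <= L by lra.
have tL : t < L by lra.
have {tL} : 2 * (p + `|ln K|) < L * del ^+ 2 by rewrite -ltr_pdivrMr.
clear e0 BL B t; rewrite exprMn.
move: (del ^+ 2) (ln K) `|ln K| nK nK0 => D x y xy y0 DL.
have L0 : 0 < L by exact: lt_le_trans ltr01 L1.
have DLL : 2 * (p + y) * L < L * D * L by rewrite ltr_pM2r.
have xyL : x <= y * L by rewrite (le_trans xy)// ler_peMr.
rewrite ler_pdivrMr// leNgt => /negP; apply.
have -> : D * L ^+ 2 = L * D * L by ring.
apply: le_lt_trans DLL.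
have -> : 2 * (p + y) * L = (y * L + p * L) * 2 by ring.
by rewrite ler_wpM2r// lerD2r.
Qed.

End growth.

Unset Implicit Arguments.

Theorem corollary12 (R : realType) (r : nat -> nat)
  (r_gt0 : forall i, (1 <= i)%N -> (1 <= r i)%N)
  (r_nondecreasing : forall i j, (1 <= i)%N -> (i <= j)%N -> (r i <= r j)%N)
  (F Ftilde : forall d : nat, function_space R (Rspace R d))
  (hF : forall d, (2 <= d)%N -> is_korobov r (F d))
  (hFtilde : forall d, (2 <= d)%N -> is_trig_korobov r (Ftilde d)) :
  [/\ (exists M, forall i, (1 <= i)%N -> (r i <= M)%N) ->
        curse_of_dimensionality (fun d => integration_complexity (Ftilde d)) /\
        curse_of_dimensionality (fun d => integration_complexity (F d)),
      Linf R r = +oo%E ->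
        almost_exponential_growth (fun d => integration_complexity (Ftilde d)) /\
        almost_exponential_growth (fun d => integration_complexity (F d)) &
      ((2 * ln (2 * pi))%:E < Linf R r)%E ->
        ~ polynomially_tractable (fun d => integration_complexity (Ftilde d)) /\
        ~ polynomially_tractable (fun d => integration_complexity (F d))].

Proof.
have ltd i : (1 <= r i.+1)%N by exact: r_gt0.
have FtN d eps : (2 <= d)%N -> 0 < eps < 1 ->
    (((1 - eps ^+ 2) * \prod_(i < d) (1 + 2 * (2 * pi) ^- (2 * r i.+1)))%:E <=
      integration_complexity (Ftilde d) eps)%E.
  move=> d2 eps01; have [rkhsF memF dotF _] := hFtilde d d2.
  by apply: (@integration_complexity_ge _ _ (fun i : 'I_d => r i.+1)).
have FN d eps : (2 <= d)%N -> 0 < eps < 1 ->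
    (((1 - eps ^+ 2) * \prod_(i < d) (1 + 2 * (2 * pi) ^- (2 * r i.+1)))%:E <=
      integration_complexity (F d) eps)%E.
  move=> d2 eps01; have [rkhsF memF dotF _] := hF d d2.
  (* Trigonometric polynomials lie in the Sobolev spaces with the same inner product, so the full
     space meets the same assumptions. *)
  have trig_sobolev (f : 'I_d -> R -> R) : (forall i, trig_mem (f i)) ->
      forall i : 'I_d, fmem (periodic_sobolev R (r i.+1)) (f i).
    by move=> ft i; have [a [b [c ->]]] := ft i; exact: sobolev_mem_trig.
  apply: (@integration_complexity_ge _ _ (fun i : 'I_d => r i.+1)) => //.
    by move=> f /trig_sobolev; exact: memF.
  by move=> f g /trig_sobolev ft /trig_sobolev; exact: dotF.
split=> [[M rM]|Loo|Lgt]; split.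
- exact: bounded_curse FtN _ rM.
- exact: bounded_curse FN _ rM.
- exact: infinite_Linf_growth FtN Loo.
- exact: infinite_Linf_growth FN Loo.
- exact: large_Linf_not_tractable FtN Lgt.
- exact: large_Linf_not_tractable FN Lgt.
Qed.
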